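(* Let $\langle A,R\rangle$ be an abstract reduction system, $\succeq$ a well-founded preorder on $R$, and $\mathcal{E}$ a complete set of decreasing elementary diagrams. Let $\mathcal{C}$ be a category and $f\colon\langle A,R\rangle\to\mathcal{C}$ a map of graphs, extended to paths by composition. Suppose that i) for every $E\in\mathcal{E}$ the diagram $f(E)$ is commutative; ii) for every $b\in\mathrm{Attr}(A)$ and every path $p\colon b\twoheadrightarrow b$ one has $f(p)=1_{f(b)}$. Then for any two paths $p,q\colon a\twoheadrightarrow b$ with $b\in\mathrm{Attr}(a)$ we have $f(p)=f(q)$.
   Context: An abstract reduction system (ARS) $\langle A,R\rangle$ is a set $A$ with a relation $R\subset A\times A$; elements $(a,b)\in R$ are called steps and written $a\to b$. A path $a\twoheadrightarrow b$ is a finite (possibly empty) sequence of consecutive steps from $a$ to $b$. A map of graphs $f\colon\langle A,R\rangle\to\mathcal{C}$ assigns to each $a\in A$ an object $f(a)$ and to each $r=(a,b)\in R$ a morphism $f(r)\colon f(a)\to f(b)$; it is extended to paths by composition, the empty path at $a$ being sent to $1_{f(a)}$. An elementary diagram (e.d.) $E$ consists of two steps with common source, $u\colon a\to b$ (top) and $l\colon a\to c$ (left), an element $d\in A$, a path $b\twoheadrightarrow d$ (right side) with steps $r_1,\dots,r_m$ and a path $c\twoheadrightarrow d$ (bottom side) with steps $d_1,\dots,d_n$ ($m,n\ge0$). $f(E)$ is commutative if the composites of $f$ along top-then-right and left-then-bottom are equal. A set $\mathcal{E}$ of e.d.s is complete if for every ordered pair of steps $a\to b$, $a\to c$ in $R$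 there is an e.d. in $\mathcal{E}$ with top $a\to b$ and left side $a\to c$. A preorder is a reflexive transitive relation; $r\succ r'$ means $r\succeq r'$ and not $r'\succeq r$; $r\sim r'$ means $r\succeq r'$ and $r'\succeq r$. A preorder $\succeq$ on $R$ is well-founded if for every infinite sequence $r_1\succeq r_2\succeq\cdots$ there is $n$ with $r_N\sim r_n$ for all $N\ge n$. An e.d. with top step $u$, left step $l$, right side with steps $r_1,\dots,r_m$ and bottom side with steps $d_1,\dots,d_n$ is decreasing if: (1) there is $0\le j\le n$ such that $u\sim d_j$ if $j\ne0$; $l\succ d_k$ for all $k<j$; and $l\succ d_k$ or $u\succ d_k$ for every $k>j$; and (2) there is $0\le s\le m$ such that $l\sim r_s$ if $s\neq 0$; $u\succ r_t$ for all $t<s$; and $u\succ r_t$ or $l\succ r_t$ for every $t>s$. An element $a\in A$ is semi-normal if for every path $a\twoheadrightarrow b$ there is a path $b\twoheadrightarrow a$. $\mathrm{Attr}(A)$ is the set of all semi-normal elements of $A$; $\mathrm{Attr}(a)$ is the set of all semi-normal $b$ such that there is a path $a\twoheadrightarrow b$. *)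

(* Defs.v *)
From Stdlib Require Import Relations List.
Import ListNotations.

Set Implicit Arguments.
Unset Strict Implicit.

(* Composition is written in diagrammatic order: [comp f g] is "f, then g". *)
Record category := Category {
  obj :> Type;
  hom : obj -> obj -> Type;
  idm : forall x : obj, hom x x;
  comp : forall x y z : obj, hom x y -> hom y z -> hom x z;
  comp_idl : forall (x y : obj) (f : hom x y), comp (idm x) f = f;
  comp_idr : forall (x y : obj) (f : hom x y), comp f (idm y) = f;
  comp_assoc : forall (w x y z : obj) (f : hom w x) (g : hom x y) (h : hom y z),
    comp f (comp g h) = comp (comp f g) h
}.

Arguments hom {c}.
Arguments idm {c}.
Arguments comp {c x y z}.

Section AbstractReduction.

Variables (A : Type) (R : relation A).

(* The elements of R, as a subset of A * A, form a type, so that R can itself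
   carry a preorder.  The membership proof is a field, hence under proof
   irrelevance a step is determined by its two endpoints. *)
Record step := Step { src : A; tgt : A; step_in : R src tgt }.

Inductive path : A -> A -> Type :=
| path_nil (a : A) : path a a
| path_cons (a b c : A) (r : R a b) (p : path b c) : path a c.

Fixpoint path_steps (a b : A) (p : path a b) : list step :=
  match p with
  | path_nil _ => []
  | path_cons r p' => Step r :: path_steps p'
  end.

Record graph_map (C : category) := GraphMap {
  map_obj :> A -> C;
  map_step : forall a b : A, R a b -> hom (map_obj a) (map_obj b)
}.

Fixpoint map_path (C : category) (f : graph_map C) (a b : A) (p : path a b)
    : hom (f a) (f b) :=
  match p in path x y return hom (f x) (f y) with
  | path_nil x => idm (f x)
  | path_cons r p' => comp (map_step f r) (map_path f p')
  end.

Record elem_diagram := ElemDiagram {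
  ed_a : A; ed_b : A; ed_c : A; ed_d : A;
  ed_top : R ed_a ed_b;
  ed_left : R ed_a ed_c;
  ed_right : path ed_b ed_d;
  ed_bottom : path ed_c ed_d
}.

Definition ed_commutes (C : category) (f : graph_map C) (E : elem_diagram) : Prop :=
  comp (map_step f (ed_top E)) (map_path f (ed_right E)) =
  comp (map_step f (ed_left E)) (map_path f (ed_bottom E)).

Definition complete (EE : elem_diagram -> Prop) : Prop :=
  forall (a b c : A) (u : R a b) (l : R a c),
    exists (d : A) (right : path b d) (bottom : path c d),
      EE (ElemDiagram u l right bottom).

Section Preorder.

Variable ge : relation step.

Definition gt (r r' : step) : Prop := ge r r' /\ ~ ge r' r.

Definition sim (r r' : step) : Prop := ge r r' /\ ge r' r.

Definition well_founded_preorder : Prop :=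
  preorder step ge /\
  forall r : nat -> step, (forall n : nat, ge (r n) (r (S n))) ->
    exists n : nat, forall N : nat, n <= N -> sim (r N) (r n).

(* [s] lists the steps s_1, ..., s_n of a side of an elementary diagram, counted
   from 1; [l] is the step adjacent to that side and [u] the one opposite to it.
   The index j = 0 means that no s_k plays the role of the step equivalent to u. *)
Definition decreasing_side (u l : step) (s : list step) : Prop :=
  exists j : nat, j <= length s /\
    forall (k : nat) (x : step), 1 <= k -> nth_error s (k - 1) = Some x ->
      (k = j -> sim u x) /\
      (k < j -> gt l x) /\
      (j < k -> gt l x \/ gt u x).

Definition decreasing (E : elem_diagram) : Prop :=
  decreasing_side (Step (ed_top E)) (Step (ed_left E)) (path_steps (ed_bottom E)) /\
  decreasing_side (Step (ed_left E)) (Step (ed_top E)) (path_steps (ed_right E)).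

End Preorder.

Definition semi_normal (a : A) : Prop :=
  forall b : A, path a b -> inhabited (path b a).

(* [in_Attr_of a b] is b in Attr(a); b in Attr(A) is [semi_normal b]. *)
Definition in_Attr_of (a b : A) : Prop :=
  semi_normal b /\ inhabited (path a b).

End AbstractReduction.

(* Main.v *)
(* Fix a and let the objects be pairs (b, m) with m : f(a) -> f(b), a step r : b -> c
   leading from (b, m) to (c, m f(r)).  Since the f(E) commute, the elementary
   diagrams lift to this system, which is therefore confluent by decreasing
   diagrams.  So (b, f(p)) and (b, f(q)) have a common reduct, that is, there are
   paths p', q' : b ->> d with f(p) f(p') = f(q) f(q'); a path d ->> b closes p' and
   q' to loops at b, which f sends to the identity.

   Decreasingness survives replacing each label by its ordinal rank, so the labels
   may be taken totally preordered; confluence of the steps of label at most x is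
   then shown by induction on x. *)

Require Import Defs.
From Stdlib Require Import Relations List Lia Classical ClassicalEpsilon.
Import ListNotations.

Set Implicit Arguments.
Unset Strict Implicit.

(** * Confluence and the diamond property *)

Definition confluent (B : Type) (r : relation B) : Prop :=
  forall a b c, clos_refl_trans B r a b -> clos_refl_trans B r a c ->
    exists d, clos_refl_trans B r b d /\ clos_refl_trans B r c d.

Lemma clos_refl_trans_mono (B : Type) (r r' : relation B) :
  (forall a b, r a b -> r' a b) ->
  forall a b, clos_refl_trans B r a b -> clos_refl_trans B r' a b.
Proof.
  intros H a b Hab; induction Hab; eauto using rt_step, rt_refl, rt_trans.
Qed.

(** Each tile has exactly one step on every side, so tiling never lengthens a path: a single step is
    first carried across a path, then a path across a path. *)
Lemma diamond_confluent (B : Type) (r : relation B) :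
  (forall a b c, r a b -> r a c -> exists d, r b d /\ r c d) -> confluent r.
Proof.
  intros Hd.
  assert (strip : forall a b, clos_refl_trans B r a b -> forall c, r a c ->
            exists d, r b d /\ clos_refl_trans B r c d).
  { intros a b Hab; induction Hab as [a b Hab | a | a b b' _ IH1 _ IH2];
      intros c Hac.
    - destruct (Hd _ _ _ Hab Hac) as (d & ? & ?); eauto using rt_step.
    - eauto using rt_refl.
    - destruct (IH1 _ Hac) as (d & Hbd & ?).
      destruct (IH2 _ Hbd) as (e & ? & ?); eauto using rt_trans. }
  intros a b c Hab Hac; revert b Hab.
  induction Hac as [a c Hac | a | a c c' _ IH1 _ IH2]; intros b Hab.
  - destruct (strip _ _ Hab _ Hac) as (d & ? & ?); eauto using rt_step.
  - eauto using rt_refl.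
  - destruct (IH1 _ Hab) as (d & ? & Hcd).
    destruct (IH2 _ Hcd) as (e & ? & ?); eauto using rt_trans.
Qed.

(** * Ordinal ranks of a well-founded relation, compared without ordinals *)

Section Rank.

Variables (L : Type) (prec : relation L).
Hypothesis prec_wf : well_founded prec.

(* Comparison of the ordinal ranks of [x] and [y] with respect to [prec]. *)
Inductive rank_le (x y : L) : Prop :=
| rank_le_intro :
    (forall x', prec x' x -> exists y', prec y' y /\ rank_le x' y') ->
    rank_le x y.

Lemma rank_le_refl x : rank_le x x.
Proof.
  induction x as [x IH] using (well_founded_ind prec_wf).
  constructor; eauto.
Qed.

Lemma rank_le_trans x y z : rank_le x y -> rank_le y z -> rank_le x z.
Proof.
  revert y z; induction x as [x IH] using (well_founded_ind prec_wf).
  intros y z [Hxy] [Hyz]; constructor; intros x' Hx'.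
  destruct (Hxy _ Hx') as (y' & Hy' & Hle).
  destruct (Hyz _ Hy') as (z' & Hz' & Hle'); eauto.
Qed.

Lemma not_rank_le x y :
  ~ rank_le x y -> exists x', prec x' x /\ forall y', prec y' y -> ~ rank_le x' y'.
Proof.
  intros H; apply NNPP; intros Hn; apply H; constructor; intros x' Hx'.
  apply NNPP; intros Hn'; apply Hn; exists x'; split; auto.
  intros y' Hy' Hle; apply Hn'; eauto.
Qed.

(** If [x] does not rank at most [y], some [x'] below [x] is dominated by no [y'] below [y]. By
    induction every such [y'] then ranks at most [x'], so [x'] witnesses [rank_le y x]. *)
Lemma rank_le_total x y : rank_le x y \/ rank_le y x.
Proof.
  revert y; induction x as [x IH] using (well_founded_ind prec_wf); intros y.
  destruct (classic (rank_le x y)) as [|H]; auto; right.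
  destruct (not_rank_le H) as (x' & Hx' & Hn).
  constructor; intros y' Hy'; exists x'; split; auto.
  destruct (IH _ Hx' y') as [Hle|]; auto.
  destruct (Hn _ Hy' Hle).
Qed.

Lemma prec_not_rank_le x y : prec y x -> ~ rank_le x y.
Proof.
  revert y; induction x as [x IH] using (well_founded_ind prec_wf).
  intros y Hyx [Hle].
  destruct (Hle _ Hyx) as (y' & Hy' & Hyy'); exact (IH _ Hyx _ Hy' Hyy').
Qed.

Lemma rank_lt_pred x y : ~ rank_le x y -> exists x', prec x' x /\ rank_le y x'.
Proof.
  revert x; induction y as [y IH] using (well_founded_ind prec_wf); intros x H.
  destruct (not_rank_le H) as (x' & Hx' & Hn).
  exists x'; split; auto; constructor; auto.
Qed.

(** The induction runs on a bound [y] for the rank of [x]: an element of smaller rank than [x] is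
    bounded by a predecessor of [x], hence by a predecessor of [y]. *)
Lemma rank_lt_wf : well_founded (fun x y => ~ rank_le y x).
Proof.
  assert (H : forall y x, rank_le x y -> Acc (fun x y => ~ rank_le y x) x).
  { induction y as [y IH] using (well_founded_ind prec_wf).
    intros x [Hxy]; constructor; intros z Hz.
    destruct (rank_lt_pred Hz) as (x' & Hx' & Hzx').
    destruct (Hxy _ Hx') as (y' & Hy' & Hle).
    apply (IH _ Hy'); eauto using rank_le_trans. }
  intros x; exact (H x x (rank_le_refl x)).
Qed.

End Rank.

(** * Decreasing diagrams for totally preordered labels *)

Section Decreasing.

Variables (B L : Type) (le : relation L) (st : L -> relation B).

Definition lt (x y : L) : Prop := ~ le y x.
Definition below (x : L) (a b : B) : Prop := exists z, lt z x /\ st z a b.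
Definition upto (x : L) (a b : B) : Prop := exists z, le z x /\ st z a b.

Hypothesis le_trans : forall x y z, le x y -> le y z -> le x z.
Hypothesis le_total : forall x y, le x y \/ le y x.
Hypothesis lt_wf : well_founded lt.

Definition path_below (x : L) : relation B := clos_refl_trans B (below x).
Definition opt (r : relation B) (a b : B) : Prop := a = b \/ r a b.

(** The three segments of a side of a decreasing diagram. The middle label is bounded rather than
    equivalent to a given one, so the bounds may be enlarged freely. *)
Definition around (u y v : L) (a b : B) : Prop :=
  exists e g, path_below u a e /\ opt (upto y) e g /\ path_below v g b.

Hypothesis peak : forall u l a b c, st u a b -> st l a c ->
  exists d,
    (exists e g, path_below l c e /\ opt (upto u) e g /\
       clos_refl_trans B (fun x y => below u x y \/ below l x y) g d) /\
    (exists e g, path_below u b e /\ opt (upto l) e g /\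
       clos_refl_trans B (fun x y => below u x y \/ below l x y) g d).

Lemma lt_le x y : lt x y -> le x y.
Proof. unfold lt; destruct (le_total x y); tauto. Qed.

Lemma le_refl x : le x x.
Proof. destruct (le_total x x); auto. Qed.

Lemma lt_le_trans x y z : lt x y -> le y z -> lt x z.
Proof. unfold lt; eauto. Qed.

Lemma le_lt_trans x y z : le x y -> lt y z -> lt x z.
Proof. unfold lt; eauto. Qed.

Lemma path_below_refl x a : path_below x a a.
Proof. apply rt_refl. Qed.

Lemma path_below_trans x a b c : path_below x a b -> path_below x b c ->
  path_below x a c.
Proof. apply rt_trans. Qed.

Lemma path_below_mono x y a b : le x y -> path_below x a b -> path_below y a b.
Proof.
  intros Hxy; apply clos_refl_trans_mono; intros c d (z & Hz & H).
  exists z; eauto using lt_le_trans.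
Qed.

Lemma upto_mono x y a b : le x y -> upto x a b -> upto y a b.
Proof. intros Hxy (z & Hz & H); exists z; eauto. Qed.

Lemma upto_below x y a b : lt x y -> upto x a b -> below y a b.
Proof. intros Hxy (z & Hz & H); exists z; eauto using le_lt_trans. Qed.

Lemma opt_path_below x y a b : lt x y -> opt (upto x) a b -> path_below y a b.
Proof.
  intros Hxy [->|H]; [apply path_below_refl|].
  apply rt_step; eauto using upto_below.
Qed.

Lemma opt_mono x y a b : le x y -> opt (upto x) a b -> opt (upto y) a b.
Proof. intros Hxy [->|H]; [left|right]; eauto using upto_mono. Qed.

(** A nonempty finite path has a largest label, since labels are totally preordered. Strict bounds
    on a path thus become a non-strict bound by a smaller label, to which an induction hypothesis
    applies. *)
Lemma path_max (P : L -> Prop) a b :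
  clos_refl_trans B (fun a b => exists z, P z /\ st z a b) a b ->
  a = b \/ exists z, P z /\ clos_refl_trans B (upto z) a b.
Proof.
  intros Hab; induction Hab as [a b (z & Hz & H) | a | a b c _ IH1 _ IH2]; auto.
  - right; exists z; split; auto; apply rt_step; exists z; auto using le_refl.
  - destruct IH1 as [->|(z & Hz & H1)]; auto.
    destruct IH2 as [<-|(z' & Hz' & H2)]; eauto.
    right; destruct (le_total z z') as [Hle|Hle].
    + exists z'; split; auto; eapply rt_trans; eauto.
      revert H1; apply clos_refl_trans_mono; eauto using upto_mono.
    + exists z; split; auto; eapply rt_trans; eauto.
      revert H2; apply clos_refl_trans_mono; eauto using upto_mono.
Qed.

Lemma confluent_of_upto (P : L -> Prop) :
  (forall z z', P z -> le z' z -> P z') ->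
  (forall z, P z -> confluent (upto z)) ->
  confluent (fun a b => exists z, P z /\ st z a b).
Proof.
  intros Pdown H a b c Hab Hac.
  destruct (path_max Hab) as [<-|(z & Hz & Hab')]; [exists c; auto using rt_refl|].
  destruct (path_max Hac) as [<-|(z' & Hz' & Hac')]; [exists b; auto using rt_refl|].
  assert (Hmax : exists t, P t /\ le z t /\ le z' t).
  { destruct (le_total z z'); eauto using le_refl. }
  destruct Hmax as (t & Ht & Hzt & Hz't).
  assert (Hsub : forall a b, clos_refl_trans B (upto t) a b ->
            clos_refl_trans B (fun a b => exists z, P z /\ st z a b) a b).
  { apply clos_refl_trans_mono; intros d e (y & ? & ?); exists y; eauto. }
  destruct (H t Ht a b c) as (d & ? & ?).
  - revert Hab'; apply clos_refl_trans_mono; eauto using upto_mono.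
  - revert Hac'; apply clos_refl_trans_mono; eauto using upto_mono.
  - exists d; auto.
Qed.

Lemma around_prefix u y v a b c : path_below u a b -> around u y v b c ->
  around u y v a c.
Proof. intros Hab (e & g & ? & ? & ?); exists e, g; eauto using path_below_trans. Qed.

Lemma around_suffix u y v a b c : around u y v a b -> path_below v b c ->
  around u y v a c.
Proof. intros (e & g & ? & ? & ?) Hbc; exists e, g; eauto using path_below_trans. Qed.

Lemma around_of_paths u y v a b c : path_below u a b -> path_below v b c ->
  around u y v a c.
Proof. intros; exists b, b; unfold opt; auto. Qed.

Lemma around_step u y v a b : upto y a b -> around u y v a b.
Proof. intros; exists a, b; unfold opt; auto using path_below_refl. Qed.

Lemma around_path_below y x a b : lt y x -> around x y x a b -> path_below x a b.
Proof. intros Hlt (e & g & ? & ? & ?);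
  eauto using path_below_trans, opt_path_below. Qed.

Definition confluent_below (x : L) : Prop := confluent (below x).

(* [around y x x] begins with labels strictly below [y], although the given path has
   labels up to [y]: this is what makes the induction in [meet] terminate. *)
Definition crosses (x y : L) : Prop := forall a b c,
  upto x a b -> clos_refl_trans B (upto y) a c ->
  exists d, around y x x c d /\ path_below x b d.

Lemma crosses_path_below x w : le w x -> (forall z, lt z w -> crosses x z) ->
  forall a b c, upto x a b -> path_below w a c ->
    exists d, around w x x c d /\ path_below x b d.
Proof.
  intros Hwx HQ a b c Hab Hac.
  destruct (path_max Hac) as [->|(z & Hz & Hac')].
  - exists b; split; [apply around_step; auto | apply path_below_refl].
  - destruct (HQ z Hz _ _ _ Hab Hac') as (d & (e & g & H1 & H2 & H3) & H4).
    exists d; split; auto; exists e, g; eauto using path_below_mono, lt_le.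
Qed.

(** Confluence below [y] handles the first segment, [crosses] the middle step, and confluence below
    [x] the last segment. The shape [around y x x] is kept, with still at most one middle step. *)
Lemma around_strip x y : le y x -> confluent_below y -> confluent_below x ->
  (forall z, lt z y -> crosses x z) ->
  forall a b c, around y x x a b -> path_below y a c ->
    exists d, around y x x c d /\ path_below x b d.
Proof.
  intros Hyx CRy CRx HQ a b c (a1 & a2 & H1 & H2 & H3) Hac.
  destruct (CRy _ _ _ H1 Hac) as (m & Ha1m & Hcm).
  destruct H2 as [<-|H2].
  - destruct (CRx _ _ _ H3 (path_below_mono Hyx Ha1m)) as (d & ? & ?).
    exists d; split; auto; eapply around_of_paths; eauto.
  - destruct (crosses_path_below Hyx HQ H2 Ha1m) as (d & Hmd & Ha2d).
    destruct (CRx _ _ _ H3 Ha2d) as (d' & ? & ?).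
    exists d'; split; auto; eapply around_prefix; eauto; eapply around_suffix; eauto.
Qed.

Lemma peak_le x y a b c : le y x -> upto x a b -> upto y a c ->
  exists d, around y x x c d /\ around x y x b d.
Proof.
  intros Hyx (u & Hu & Hab) (l & Hl & Hac).
  assert (Hsub : forall g d,
    clos_refl_trans B (fun x y => below u x y \/ below l x y) g d ->
      path_below x g d).
  { apply clos_refl_trans_mono; intros g d [(z & Hz & H)|(z & Hz & H)];
      exists z; eauto using lt_le_trans. }
  destruct (peak Hab Hac) as
    (d & (e & g & H1 & H2 & H3) & (e' & g' & H1' & H2' & H3')).
  exists d; split; [exists e, g | exists e', g']; repeat split; auto;
    eauto using path_below_mono, opt_mono.
Qed.

(** * Joining an [x]-step and a [y]-step separated by a path of smaller labels *)

Section Meet.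

Variables x y : L.
Hypothesis yx : lt y x \/ y = x.
Hypotheses (CRy : confluent_below y) (CRx : confluent_below x).
Hypotheses (Qx : forall z, lt z y -> crosses x z)
  (Qy : forall z, lt z y -> crosses y z).

Lemma meet_le : le y x.
Proof. destruct yx as [H|<-]; auto using lt_le, le_refl. Qed.

(** For [y] < [x] the path is entirely below [x], and confluence below [x] suffices; for [y = x]
    this is [around_strip]. *)
Lemma around_strip_swap a b c :
  around x y x a b -> path_below x a c ->
    exists d, around x y x c d /\ path_below x b d.
Proof.
  intros Hab Hac; destruct yx as [H|E].
  - destruct (CRx (around_path_below H Hab) Hac) as (d & ? & ?).
    exists d; split; auto; eapply around_of_paths; eauto using path_below_refl.
  - subst y; eapply around_strip; eauto using le_refl.
Qed.

(* Carrying the [x]-step along the path below [w] and then the [y]-step along the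
   path so created leaves a path of labels below some [z] < [w] between the two. *)
Lemma meet w : le w y -> forall a b a' c,
  upto x a b -> path_below w a a' -> upto y a' c ->
  exists d, around y x x c d /\ around x y x b d.
Proof.
  assert (Hyx := meet_le).
  induction w as [w IH] using (well_founded_ind lt_wf).
  intros Hwy a b a' c Hab Haa' Ha'c.
  destruct (path_max Haa') as [<-|(z & Hz & Haz)].
  { apply peak_le with a; auto. }
  assert (Hzy : lt z y) by eauto using lt_le_trans.
  destruct (Qx Hzy Hab Haz) as (h & (e & g & Ha'e & Heg & Hgh) & Hbh).
  destruct (fun H => crosses_path_below (lt_le Hzy) H Ha'c Ha'e)
    as (h1 & (e1 & g1 & Hee1 & Heg1 & Hgh1) & Hch1).
  { intros t Ht; apply Qy; eauto using lt_le_trans, lt_le. }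
  assert (Hee1' : path_below y e e1) by eauto using path_below_mono, lt_le.
  (* At [e] the situation is again the initial one: an [x]-step to [g], and a path below [z] to [e1]
     followed by a [y]-step to [g1]. Either residual step may have vanished; these two cases need no
     recursion. *)
  destruct Heg as [<-|Heg].
  - destruct (around_strip_swap (a := e) (b := h1) (c := h)) as (d & ? & ?); auto.
    { exists e1, g1; eauto using path_below_mono. }
    exists d; split; [eapply around_of_paths | eapply around_prefix]; eauto.
  - destruct Heg1 as [<-|Heg1].
    + destruct (crosses_path_below Hyx Qx Heg (path_below_trans Hee1' Hgh1))
      as (d & ? & Hgd).
      destruct (CRx Hgh Hgd) as (d' & ? & ?).
      exists d'; split.
      * eapply around_prefix; eauto; eapply around_suffix; eauto.
      * eapply around_of_paths; eauto.
    (* After the recursive call both results are projected along the remaining tails, [g] to [h] and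
       [g1] to [h1], and confluence below [x] joins the two ends. *)
    + destruct (IH z Hz (lt_le Hzy) _ _ _ _ Heg Hee1 Heg1) as (d & Hd1 & Hd2).
      destruct (around_strip_swap Hd2 Hgh) as (d2 & ? & Hdd2).
      destruct (around_strip Hyx CRy CRx Qx Hd1 Hgh1) as (d1 & ? & Hdd1).
      destruct (CRx Hdd1 Hdd2) as (d3 & ? & ?).
      exists d3; split; (eapply around_prefix; [eauto|]; eapply around_suffix; eauto).
Qed.

End Meet.

(** * Crossing whole paths, and the induction on labels *)

Fixpoint iter (r : relation B) (n : nat) (a b : B) : Prop :=
  match n with
  | 0 => a = b
  | S n => exists c, r a c /\ iter r n c b
  end.

Lemma clos_iter (r r' : relation B) a b : (forall a b, r a b -> r' a b) ->
  clos_refl_trans B r a b -> exists n, iter r' n a b.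
Proof.
  intros Hr H; apply clos_rt_rt1n in H; induction H as [a | a b c Hab _ (n & IH)].
  - exists 0; reflexivity.
  - exists (S n), b; auto.
Qed.

(** The path is cut into blocks [around y y y] instead of steps, because projecting along a path
    below [y] preserves the number of blocks but not the number of steps. Induction on that number
    then carries the [x]-step across one block at a time. *)
Lemma crosses_of_meet x y : lt y x -> confluent_below y -> confluent_below x ->
  (forall z, lt z y -> crosses x z) ->
    (forall z, lt z y -> crosses y z) -> crosses x y.
Proof.
  intros Hlt CRy CRx Qx Qy.
  assert (Hyx := lt_le Hlt).
  assert (iter_path_below : forall n a b, iter (around y y y) n a b ->
    path_below x a b).
  { induction n as [|n IH]; intros a b; simpl.
    - intros ->; apply path_below_refl.
    - intros (c & (e & g & ? & ? & ?) & ?).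
      apply path_below_trans with e; [eauto using path_below_mono|].
      apply path_below_trans with g; [eauto using opt_path_below|].
      apply path_below_trans with c; eauto using path_below_mono. }
  assert (iter_strip : forall n a b c, iter (around y y y) n a b ->
    path_below y a c ->
            exists d, iter (around y y y) n c d /\ path_below y b d).
  { induction n as [|n IH]; intros a b c Hab Hac; simpl in Hab.
    - subst b; exists c; split; simpl; auto.
    - destruct Hab as (a1 & Haa1 & Ha1b).
      destruct (around_strip (le_refl y) CRy CRy Qy Haa1 Hac) as (d & ? & Hd).
      destruct (IH _ _ _ Ha1b Hd) as (d' & ? & ?).
      exists d'; split; auto; exists d; auto. }
  assert (one : forall a b c, upto x a b -> around y y y a c ->
            exists d, around y x x c d /\ path_below x b d).
  { intros a b c Hab (a1 & a2 & H1 & [<-|H2] & H3).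
    - eapply crosses_path_below; eauto using path_below_trans.
    - destruct (meet (or_introl Hlt) CRy CRx Qx Qy (le_refl y) Hab H1 H2)
        as (d & Hd & Hbd).
      destruct (around_strip Hyx CRy CRx Qx Hd H3) as (d' & ? & ?).
      exists d'; split; eauto using path_below_trans, around_path_below. }
  intros a b c Hab Hac.
  destruct (clos_iter (r' := around y y y) (fun a b => @around_step y y y a b) Hac)
    as (n & Hn).
  clear Hac; revert a b c Hab Hn.
  induction n as [|n IH]; intros a b c Hab Hac; simpl in Hac.
  - subst c; exists b; split; [apply around_step; auto | apply path_below_refl].
  - destruct Hac as (a1 & Haa1 & Ha1c).
    destruct (one _ _ _ Hab Haa1) as (d & (e & g & Ha1e & Heg & Hgd) & Hbd).
    (* The residual [x]-step starts at [e], not at [a1], so the remaining [n] blocks are first moved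
       to [e]. *)
    destruct (iter_strip _ _ _ _ Ha1c Ha1e) as (c' & Hec' & Hcc').
    destruct Heg as [<-|Heg].
    + destruct (CRx _ _ _ Hgd (iter_path_below _ _ _ Hec')) as (d' & ? & ?).
      exists d'; split; [eapply around_of_paths | eapply path_below_trans]; eauto.
    + destruct (IH _ _ _ Heg Hec') as (d2 & ? & Hgd2).
      destruct (CRx _ _ _ Hgd Hgd2) as (d3 & ? & ?).
      exists d3; split.
      * eapply around_prefix; eauto; eapply around_suffix; eauto.
      * eapply path_below_trans; eauto.
Qed.

(** The relation [around x x x] has the diamond property, by [meet] with both labels equal to [x],
    and its reflexive transitive closure is that of [upto x]. *)
Lemma confluent_upto_of_crosses x :
  confluent_below x -> (forall z, lt z x -> crosses x z) -> confluent (upto x).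
Proof.
  intros CRx Qx.
  assert (strip := around_strip (le_refl x) CRx CRx Qx).
  assert (diamond : confluent (around x x x)).
  { apply diamond_confluent; intros a b c (a1 & a2 & H1 & H2 & H3) Hac.
    destruct (strip _ _ _ Hac H1) as (c1 & Ha1c1 & Hcc1).
    destruct H2 as [<-|H2].
    - destruct (strip _ _ _ Ha1c1 H3) as (d & ? & ?).
      exists d; split; auto; eapply around_of_paths; eauto.
    - destruct Ha1c1 as (a5 & a6 & H4 & [<-|H5] & H6).
      + destruct (crosses_path_below (le_refl x) Qx H2 (path_below_trans H4 H6))
        as (d & ? & Hd).
        destruct (CRx _ _ _ H3 Hd) as (d' & ? & ?).
        exists d'; split.
        * eapply around_of_paths; eauto using path_below_refl.
        * eapply around_prefix; eauto; eapply around_suffix; eauto.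
      + destruct (meet (or_intror eq_refl) CRx CRx Qx Qx (le_refl x) H2 H4 H5)
          as (d & Hd1 & Hd2).
        destruct (strip _ _ _ Hd1 H6) as (d1 & ? & Hdd1).
        destruct (strip _ _ _ Hd2 H3) as (d2 & ? & Hdd2).
        destruct (CRx _ _ _ Hdd1 Hdd2) as (d3 & ? & ?).
        exists d3; split; [| eapply around_prefix; eauto];
          eapply around_suffix; eauto. }
  assert (into : forall a b, clos_refl_trans B (upto x) a b ->
            clos_refl_trans B (around x x x) a b).
  { apply clos_refl_trans_mono; intros; apply around_step; auto. }
  assert (SU : forall a b, path_below x a b -> clos_refl_trans B (upto x) a b).
  { apply clos_refl_trans_mono; intros a b (z & Hz & H).
    exists z; auto using lt_le. }
  assert (out : forall a b, clos_refl_trans B (around x x x) a b ->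
            clos_refl_trans B (upto x) a b).
  { intros a b H; induction H as [a b (e & g & H1 & H2 & H3)| |];
      eauto using rt_refl, rt_trans.
    apply rt_trans with e; auto; apply rt_trans with g; auto.
    destruct H2 as [<-|H2]; eauto using rt_refl, rt_step. }
  intros a b c Hab Hac.
  destruct (diamond _ _ _ (into _ _ Hab) (into _ _ Hac)) as (d & ? & ?); eauto.
Qed.

(** Both claims are proved together: [crosses x y] needs [crosses y z] for the smaller label [y] and
    confluence below [x], which comes from the first claim at smaller labels. Inside, a second
    induction on [y] supplies [crosses x z] for [z] < [y]. *)
Lemma decreasing_upto x :
  confluent (upto x) /\ forall y, lt y x -> crosses x y.
Proof.
  induction x as [x IH] using (well_founded_ind lt_wf).
  assert (CRle : forall y, le y x -> confluent_below y).
  { intros y Hy; apply confluent_of_upto; [eauto using le_lt_trans|].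
    intros z Hz; apply IH; eauto using lt_le_trans. }
  assert (HQ : forall y, lt y x -> crosses x y).
  { induction y as [y IHy] using (well_founded_ind lt_wf); intros Hy.
    apply crosses_of_meet; auto using lt_le, le_refl.
    - intros z Hz; apply IHy; eauto using lt_le_trans, lt_le.
    - apply IH; auto. }
  split; auto using confluent_upto_of_crosses, le_refl.
Qed.

Theorem decreasing_confluent : confluent (fun a b => exists x, st x a b).
Proof.
  assert (H : confluent (fun a b => exists x, True /\ st x a b)).
  { apply confluent_of_upto; auto; intros x _; apply decreasing_upto. }
  intros a b c Hab Hac; destruct (H a b c) as (d & Hbd & Hcd).
  - revert Hab; apply clos_refl_trans_mono; firstorder.
  - revert Hac; apply clos_refl_trans_mono; firstorder.
  - exists d; split; [revert Hbd | revert Hcd]; apply clos_refl_trans_mono; firstorder.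
Qed.

End Decreasing.

(** * Sides of decreasing diagrams, and the strict part of the preorder *)

Lemma decreasing_side_split (A : Type) (R : relation A) (ge : relation (step R))
    (u l : step R) (s : list (step R)) :
  decreasing_side ge u l s ->
  exists s1 s2 s3, s = s1 ++ s2 ++ s3 /\
    (forall x, In x s1 -> gt ge l x) /\
    (s2 = [] \/ exists x, s2 = [x] /\ sim ge u x) /\
    (forall x, In x s3 -> gt ge l x \/ gt ge u x).
Proof.
  intros (j & Hj & H).
  (* Positions are shifted to count from 0 as [nth_error] does; the distinguished position [j]
     becomes [S n = j], and [j = 0] matches no position. *)
  assert (H' : forall n x, nth_error s n = Some x ->
    (S n = j -> sim ge u x) /\ (S n < j -> gt ge l x) /\
    (j < S n -> gt ge l x \/ gt ge u x)).
  { intros n x Hn; apply H; [lia|].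
    replace (S n - 1) with n by lia; exact Hn. }
  clear H; destruct j as [|i].
  - exists [], [], s; split; [reflexivity|]; split; [simpl; tauto|]; split; auto.
    intros x Hx; destruct (In_nth_error _ _ Hx) as (n & Hn).
    apply (H' n x Hn); lia.
  - destruct (nth_error s i) as [x|] eqn:Hx.
    2: { apply nth_error_None in Hx; lia. }
    destruct (H' i x Hx) as (Hsim & _).
    destruct (nth_error_split _ _ Hx) as (s1 & s3 & -> & Hi).
    exists s1, [x], s3; split; [reflexivity|].
    split; [|split; [right; exists x; auto|]].
    + intros y Hy; destruct (In_nth_error _ _ Hy) as (n & Hn).
      assert (n < length s1) by (apply nth_error_Some; congruence).
      apply (H' n y); [|lia]; rewrite nth_error_app1; auto.
    + intros y Hy; destruct (In_nth_error _ _ Hy) as (n & Hn).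
      apply (H' (S (length s1 + n)) y); [|lia].
      rewrite nth_error_app2 by lia.
      replace (S (length s1 + n) - length s1) with (S n) by lia; exact Hn.
Qed.

(** Every inaccessible step has an inaccessible step strictly below it. Choice turns this into an
    infinite strictly descending sequence, which cannot stabilise up to [sim]. *)
Lemma gt_well_founded (A : Type) (R : relation A) (ge : relation (step R)) :
  well_founded_preorder ge -> well_founded (fun x y => gt ge y x).
Proof.
  intros [_ Hwf] x0; apply NNPP; intros H0.
  set (bad := {x | ~ Acc (fun x y => gt ge y x) x}).
  assert (next : forall x : bad, {y : bad | gt ge (proj1_sig x) (proj1_sig y)}).
  { intros [x Hx]; apply constructive_indefinite_description.
    apply NNPP; intros Hn; apply Hx; constructor; intros y Hy.
    apply NNPP; intros Hy'; apply Hn; exists (exist _ y Hy'); exact Hy. }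
  set (r := fix r (n : nat) : bad :=
    match n with 0 => exist _ x0 H0 | S n => proj1_sig (next (r n)) end).
  assert (Hr : forall n, gt ge (proj1_sig (r n)) (proj1_sig (r (S n)))).
  { intros n; exact (proj2_sig (next (r n))). }
  destruct (Hwf (fun n => proj1_sig (r n))) as (n & Hn).
  { intros n; apply Hr. }
  destruct (Hn (S n)) as [Hsn _]; [lia|].
  destruct (Hr n) as [_ Hns]; auto.
Qed.

(** * Concatenation of paths *)

Fixpoint path_app (A : Type) (R : relation A) (a b c : A) (p : path R a b)
    : path R b c -> path R a c :=
  match p in path _ a b return path R b c -> path R a c with
  | path_nil _ _ => fun q => q
  | path_cons r p => fun q => path_cons r (path_app p q)
  end.

Lemma map_path_app (A : Type) (R : relation A) (C : category) (f : graph_map R C)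
    (a b c : A) (p : path R a b) (q : path R b c) :
  map_path f (path_app p q) = comp (map_path f p) (map_path f q).
Proof.
  induction p as [a | a b' b r p IH]; simpl.
  - rewrite comp_idl; reflexivity.
  - rewrite IH; apply comp_assoc.
Qed.

(** * The lifted system of elements paired with morphisms *)

Section Lift.

Variables (A : Type) (R : relation A) (C : category) (f : graph_map R C) (o : C).

Definition point : Type := {b : A & hom o (f b)}.

(* Two paths from the same source have the same image under [f] as soon as they
   lead to the same point when lifted to this system. *)
Definition lift_step (s : step R) (x y : point) : Prop :=
  exists (c : A) (r : R (projT1 x) c),
    s = Step r /\ y = existT _ c (comp (projT2 x) (map_step f r)).

(** Plain lists of steps, rather than typed paths, allow a side to be cut by [++] into the pieces of
    [decreasing_side_split]. *)
Fixpoint run (s : list (step R)) (x y : point) : Prop :=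
  match s with
  | [] => x = y
  | r :: s => exists z, lift_step r x z /\ run s z y
  end.

Lemma run_app s1 s2 x y : run (s1 ++ s2) x y -> exists z, run s1 x z /\ run s2 z y.
Proof.
  revert x; induction s1 as [|r s1 IH]; simpl; intros x H.
  - exists x; auto.
  - destruct H as (z & Hxz & H); destruct (IH _ H) as (t & ? & ?).
    exists t; split; auto; exists z; auto.
Qed.

Lemma run_path b c (p : path R b c) (m : hom o (f b)) :
  run (path_steps p) (existT _ b m) (existT _ c (comp m (map_path f p))).
Proof.
  revert m; induction p as [b | b c d r p IH]; simpl; intros m.
  - rewrite comp_idr; reflexivity.
  - exists (existT _ c (comp m (map_step f r))); split.
    + exists c, r; auto.
    + rewrite comp_assoc; apply IH.
Qed.

Lemma run_clos (r : relation point) s x y :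
  (forall t, In t s -> forall x y, lift_step t x y -> r x y) ->
  run s x y -> clos_refl_trans point r x y.
Proof.
  revert x; induction s as [|t s IH]; simpl; intros x Hr H.
  - subst y; apply rt_refl.
  - destruct H as (z & Hxz & H).
    apply rt_trans with z; [apply rt_step|]; eauto.
Qed.

Lemma lifted_path x y :
  clos_refl_trans point (fun x y => exists s, lift_step s x y) x y ->
  exists p : path R (projT1 x) (projT1 y), projT2 y = comp (projT2 x) (map_path f p).
Proof.
  intros H; apply clos_rt_rt1n in H.
  induction H as [x | x y z (s & c & r & _ & Hy) _ (p & Hp)].
  - exists (path_nil R (projT1 x)); simpl; rewrite comp_idr; reflexivity.
  - subst y; simpl in p, Hp.
    exists (path_cons r p); simpl; rewrite Hp, comp_assoc; reflexivity.
Qed.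

Variables (ge : relation (step R)) (EE : elem_diagram R -> Prop).
Hypothesis ge_wf : well_founded_preorder ge.
Hypothesis EE_complete : complete EE.
Hypothesis EE_decreasing : forall E, EE E -> decreasing ge E.
Hypothesis EE_commutes : forall E, EE E -> ed_commutes f E.

Definition step_le : relation (step R) := rank_le (fun x y => gt ge y x).

Lemma gt_step_lt x y : gt ge x y -> lt step_le y x.
Proof. apply (prec_not_rank_le (gt_well_founded ge_wf)). Qed.

(** By transitivity, whatever is strictly below [y] is strictly below [x]. *)
Lemma sim_step_le x y : sim ge x y -> step_le y x.
Proof.
  intros [Hxy _]; destruct ge_wf as [[_ ge_trans] _].
  constructor; intros z [Hyz Hzy]; exists z; split.
  - split; [eauto|]; intros Hzx; apply Hzy; eauto.
  - apply (rank_le_refl (gt_well_founded ge_wf)).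
Qed.

Lemma lift_side u l x y s : decreasing_side ge u l s -> run s x y ->
  exists e g, path_below step_le lift_step l x e /\
    opt (upto step_le lift_step u) e g /\
    clos_refl_trans point
      (fun x y => below step_le lift_step u x y \/ below step_le lift_step l x y) g y.
Proof.
  intros Hs H.
  destruct (decreasing_side_split Hs) as (s1 & s2 & s3 & -> & H1 & H2 & H3).
  destruct (run_app H) as (e & Hxe & H'); destruct (run_app H') as (g & Heg & Hgy).
  exists e, g; repeat split.
  - revert Hxe; apply run_clos; intros t Ht a b Hab; exists t.
    split; auto using gt_step_lt.
  - destruct H2 as [->|(t & -> & Ht)]; [left; exact Heg|right].
    destruct Heg as (z & Hz & <-); exists t; auto using sim_step_le.
  - revert Hgy; apply run_clos; intros t Ht a b Hab.
    destruct (H3 t Ht); [right|left]; exists t; auto using gt_step_lt.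
Qed.

Lemma lift_confluent : confluent (fun x y => exists s, lift_step s x y).
Proof.
  assert (wf := gt_well_founded ge_wf).
  apply decreasing_confluent with step_le.
  - intros x y z; apply (rank_le_trans wf).
  - apply (rank_le_total wf).
  - apply (rank_lt_wf wf).
  - intros ? ? [a m] ? ? (b & u & -> & ->) (c & l & -> & ->); simpl in *.
    destruct (EE_complete u l) as (d & right & bottom & HE).
    destruct (EE_decreasing HE) as [Hb Hr]; simpl in Hb, Hr.
    assert (HC := EE_commutes HE); unfold ed_commutes in HC; simpl in HC.
    assert (Rr := run_path right (comp m (map_step f u))).
    assert (Rb := run_path bottom (comp m (map_step f l))).
    (* Commutativity of [f(E)] makes the two lifted sides end at the same point, not merely over the
       same element [d]. *)
    rewrite <- comp_assoc in Rr, Rb; rewrite <- HC in Rb.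
    exists (existT _ d (comp m (comp (map_step f u) (map_path f right)))).
    split; [exact (lift_side Hb Rb)|].
    destruct (lift_side Hr Rr) as (e & g & H1 & H2 & H3).
    exists e, g; repeat split; auto.
    revert H3; apply clos_refl_trans_mono; tauto.
Qed.

End Lift.

(** * Parallel paths into a semi-normal element *)

Theorem theorem3p4 (A : Type) (R : relation A)
  (ge : relation (step R)) (hge : well_founded_preorder ge)
  (EE : elem_diagram R -> Prop) (hcomplete : complete EE)
  (hdecr : forall E : elem_diagram R, EE E -> decreasing ge E)
  (C : category) (f : graph_map R C)
  (hcomm : forall E : elem_diagram R, EE E -> ed_commutes f E)
  (hloop : forall b : A, semi_normal R b ->
    forall p : path R b b, map_path f p = idm (f b)) :
  forall (a b : A) (p q : path R a b), in_Attr_of R a b ->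
    map_path f p = map_path f q.
Proof.
  intros a b p q [Hb _].
  set (start := existT (fun b => hom (f a) (f b)) a (idm (f a)) : point f (f a)).
  assert (lift : forall p : path R a b, clos_refl_trans (point f (f a))
    (fun x y => exists s, lift_step s x y) start (existT _ b (map_path f p))).
  (* The point [start] carries the identity, so lifting [r] from it yields [f(r)] only after
     removing a left identity. *)
  { intros r; rewrite <- (comp_idl (map_path f r)).
    apply run_clos with (path_steps r); [eauto|apply run_path]. }
  destruct (lift_confluent hge hcomplete hdecr hcomm (lift p) (lift q))
    as (z & Hp & Hq).
  destruct (lifted_path Hp) as (p' & Ep); destruct (lifted_path Hq) as (q' & Eq).
  simpl in p', q', Ep, Eq.
  destruct (Hb _ p') as [r].
  assert (close : forall p' : path R b (projT1 z),
    comp (map_path f p') (map_path f r) = idm (f b)).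
  { intros t; rewrite <- (hloop b Hb (path_app t r)), map_path_app; reflexivity. }
  (* The identity after [f(p)] is expanded through [p'] and the one after [f(q)] through [q']; both
     sides then equal [projT2 z] followed by [f(r)]. *)
  rewrite <- (comp_idr (map_path f p)), <- (comp_idr (map_path f q)).
  rewrite <- (close p') at 1; rewrite <- (close q').
  rewrite !comp_assoc, <- Ep, <- Eq; reflexivity.
Qed.
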